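(* Let $R$ be a left Zacharias domain which is a (commutative) principal ideal domain, let $\mathsf R$ be a multivariate Ore extension of $R$ in which each $\alpha_i$ is an automorphism of $R$, let $F=\{g_1,\dots,g_u\}\subset\mathsf R^m\setminus\{0\}$ and let $\mathsf M=\mathbb I_L(F)$ be the left module generated by $F$. Let $\mathfrak{GM}$ be a useful S-pair set for $F$. Then $F$ is a left Gröbner basis of $\mathsf M$ if and only if each S-polynomial $B(i,j)$ with $\{i,j\}\in\mathfrak{GM}$ has a left Gröbner representation in terms of $F$.
   Context: **Ore extensions.** A multivariate Ore extension $\mathsf R=R[Y_1;\alpha_1,\delta_1]\cdots[Y_n;\alpha_n,\delta_n]$ of a domain $R$ is an iterated Ore extension ($Y_i\star r=\alpha_i(r)Y_i+\delta_i(r)$, $\alpha_i$ an injective ring endomorphism mapping $R$ to $R$, $\delta_i$ an $\alpha_i$-derivation mapping $R$ to $R$) such that $\alpha_j\delta_i=\delta_i\alpha_j$ for $i\ne j$, $\alpha_i\alpha_j=\alpha_j\alpha_i$, $\delta_i\delta_j=\delta_j\delta_i$, and $\alpha_j(Y_i)=Y_i$, $\delta_j(Y_i)=0$ for $i<j$. Its multiplication is $\star$. It is a free left $R$-module on the set of terms $\mathcal T=\{Y_1^{a_1}\cdots Y_n^{a_n}\}$, a commutative monoid. For $\tau=Y_1^{a_1}\cdots Y_n^{a_n}$ put $\alpha_\tau=\alpha_1^{a_1}\cdots\alpha_n^{a_n}:R\to R$. The associated graded Ore extension $\mathsf S$ is the same left $R$-module with multiplication $\ast$ determined by $(a\tau)\ast(b\omega)=a\,\alpha_\tau(b)\,\tau\omega$.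 **Orderings.** $\mathsf R^m$ has canonical basis $\mathbf e_1,\dots,\mathbf e_m$ and terms $\mathcal T^{(m)}=\{t\mathbf e_i\}$. Fix a term ordering $\prec$ on $\mathcal T$ and a compatible term ordering $<$ on $\mathcal T^{(m)}$: a well-ordering with $\omega_1\prec\omega_2\Rightarrow\omega_1t<\omega_2t$ and $t_1<t_2\Rightarrow\omega t_1<\omega t_2$. $\mathbf T(f)$, $\mathrm{lc}(f)$, $\mathbf M(f)=\mathrm{lc}(f)\mathbf T(f)$ are maximal term, leading coefficient and maximal monomial. **Gröbner notions.** $F$ is a left (weak) Gröbner basis of $\mathsf M=\mathbb I_L(F)$ if for every $f\in\mathsf M\setminus\{0\}$, $\mathbf M(f)=\sum_ia_i\lambda_i\ast\mathbf M(g_{j_i})$ with $a_i\in R\setminus\{0\}$, $\lambda_i\in\mathcal T$, $\lambda_i\mathbf T(g_{j_i})=\mathbf T(f)$. A left Gröbner representation of $f$ is $f=\sum_il_i\star g_i$ with $l_i\in\mathsf R$ and $\mathbf T(l_i)\mathbf T(g_i)\le\mathbf T(f)$ whenever $l_i\ne0$ (zero has the trivial representation). **S-pairs.** Write $\mathbf M(g_i)=c_i\tau_i\mathbf e_{l_i}$. For $i<j$ with $\mathbf e_{l_i}=\mathbf e_{l_j}$ put $\tau(i,j)=\mathrm{lcm}(\tau_i,\tau_j)$, $a_{ij}=\alpha_{\tau(i,j)/\tau_i}(c_i)$, $a_{ji}=\alpha_{\tau(i,j)/\tau_j}(c_j)$, $c(i,j)=\mathrm{lcm}(a_{ij},a_{ji})$,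 $b(i,j)=\frac{c(i,j)}{a_{ji}}\frac{\tau(i,j)}{\tau_j}e_j-\frac{c(i,j)}{a_{ij}}\frac{\tau(i,j)}{\tau_i}e_i\in\mathsf S^u$ and $B(i,j)=\frac{c(i,j)}{a_{ji}}\frac{\tau(i,j)}{\tau_j}\star g_j-\frac{c(i,j)}{a_{ij}}\frac{\tau(i,j)}{\tau_i}\star g_i$. Let $\mathfrak s_L:\mathsf S^u\to\mathsf S^m$, $\sum h_ie_i\mapsto\sum h_i\ast\mathbf M(g_i)$. A left Gebauer–Möller set for $F$ is a set of generators of the left $\mathsf S$-module $\ker(\mathfrak s_L)$, each homogeneous (i.e. of the form $\sum a_i\lambda_ie_i$, $a_i\in R$, $\lambda_i\in\mathcal T$, with $\lambda_i\mathbf T(g_i)$ the same term for all $i$ with $a_i\ne0$). A useful S-pair set for $F$ is a subset $\mathfrak{GM}\subset\{\{i,j\}:1\le i<j\le u,\ \mathbf e_{l_i}=\mathbf e_{l_j}\}$ such that $\{b(i,j):\{i,j\}\in\mathfrak{GM}\}$ is a left Gebauer–Möller set for $F$. **Zacharias ring.** A ring $R$ with identity is a left Zacharias ring if it is noetherian, there is an algorithm deciding membership of $c\in R^m$ in the left module generated by a finite $\{c_1,\dots,c_t\}\subset R^m\setminus\{0\}$ and producing $d_i$ with $c=\sum d_ic_i$ when it holds, and there is an algorithm computing a finite generating set of the left syzygy module of $c_1,\dots,c_t$. *)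

(* Defs.v *)
From HB Require Import structures.
From mathcomp Require Import all_boot all_order all_algebra.
From mathcomp Require Import mpoly.
From Stdlib Require Import ClassicalEpsilon.

Set Implicit Arguments.
Unset Strict Implicit.
Unset Printing Implicit Defensive.

Import GRing.Theory.
Local Open Scope ring_scope.

Definition left_ideal (R : nzRingType) (I : R -> Prop) : Prop :=
  [/\ I 0, forall x y, I x -> I y -> I (x + y) & forall r x, I x -> I (r * x)].

Definition principal_ideal_domain (R : idomainType) : Prop :=
  forall I : R -> Prop, left_ideal I ->
    exists a, forall x, I x <-> exists r, x = r * a.

(* An algorithm is rendered as an informative ([Type]-valued) function. *)
Record left_zacharias (R : nzRingType) : Type := LeftZacharias {
  zacharias_noetherian : forall I : R -> Prop, left_ideal I ->
    exists k (a : 'I_k -> R),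
      forall x, I x <-> exists d : 'I_k -> R, x = \sum_i d i * a i;
  zacharias_member : forall m t (c : 'I_t -> 'rV[R]_m), (forall i, c i != 0) ->
    forall x : 'rV[R]_m,
      {d : 'I_t -> R | x = \sum_i d i *: c i}
      + {~ exists d : 'I_t -> R, x = \sum_i d i *: c i};
  zacharias_syzygies : forall m t (c : 'I_t -> 'rV[R]_m),
    (forall i, c i != 0) ->
    {s : seq 'rV[R]_t | forall d : 'rV[R]_t,
       \sum_i d 0 i *: c i = 0 <->
       exists e : 'I_(size s) -> R, d = \sum_k e k *: s`_k}
}.

(* The data (alpha_i, delta_i) on R; their extension to the variables is       *)
(* forced by alpha_j(Y_i) = Y_i and delta_j(Y_i) = 0.                          *)
Record ore_data (R : idomainType) (n : nat) := OreData {
  oalpha : 'I_n -> {rmorphism R -> R};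
  odelta : 'I_n -> {additive R -> R};
  oalpha_inj : forall i, injective (oalpha i);
  odeltaM : forall i a b,
    odelta i (a * b) = oalpha i a * odelta i b + odelta i a * b;
  oalphaC : forall i j a, oalpha i (oalpha j a) = oalpha j (oalpha i a);
  odeltaC : forall i j a, odelta i (odelta j a) = odelta j (odelta i a);
  oalpha_deltaC : forall i j a, i != j ->
    oalpha j (odelta i a) = odelta i (oalpha j a)
}.

Section FreeModuleSums.

Variables (R : idomainType) (n : nat) (V : zmodType).
Variables (Phi : 'X_{1..n} -> R -> V) (PhiB : forall w, zmod_morphism (Phi w)).

Local Notation msum f := (\sum_(w <- msupp f) Phi w f@_w).

Lemma msum_wide (s : seq 'X_{1..n}) f : uniq s -> {subset msupp f <= s} ->
  msum f = \sum_(w <- s) Phi w f@_w.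
Proof.
have Phi0 w : Phi w 0 = 0 by have := PhiB w 0 0; rewrite !subrr.
move=> us sub.
rewrite [RHS](bigID (mem (msupp f))) /= [X in _ = _ + X]big1 ?addr0; last first.
  by move=> w /memN_msupp_eq0 ->; rewrite Phi0.
rewrite -[RHS]big_filter; apply: perm_big; apply: uniq_perm.
- exact: msupp_uniq.
- exact: filter_uniq.
- move=> w; rewrite mem_filter /=.
  by case E: (w \in msupp f) => //=; rewrite sub.
Qed.

Lemma msumB : zmod_morphism (fun f => msum f).
Proof.
move=> f g; pose s := undup (msupp f ++ msupp g).
have us : uniq s by apply: undup_uniq.
rewrite (@msum_wide s f) //; last first.
  by move=> w hw; rewrite mem_undup mem_cat hw.
rewrite (@msum_wide s g) //; last first.
  by move=> w hw; rewrite mem_undup mem_cat hw orbT.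
rewrite (@msum_wide s (f - g)) //; last first.
  by move=> w /msuppB_le; rewrite mem_undup.
by rewrite -sumrB; apply: eq_bigr => w _; rewrite mcoeffB PhiB.
Qed.

Lemma msum_mon a w : msum (a *: 'X_[w]) = Phi w a.
Proof.
rewrite (@msum_wide [:: w]) //; last first.
  by move=> v /msuppZ_le; rewrite msuppX.
by rewrite big_seq1 mcoeffZ mcoeffX eqxx mulr1.
Qed.

End FreeModuleSums.

Lemma additive_ext (R : idomainType) n (V : zmodType)
    (F G : {mpoly R[n]} -> V) :
  zmod_morphism F -> zmod_morphism G ->
  (forall a w, F (a *: 'X_[w]) = G (a *: 'X_[w])) -> F =1 G.
Proof.
move=> FB GB eqFG f.
pose aF := GRing.isZmodMorphism.Build _ _ F FB.
pose aG := GRing.isZmodMorphism.Build _ _ G GB.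
pose F' : {additive _ -> _} := HB.pack F aF.
pose G' : {additive _ -> _} := HB.pack G aG.
rewrite -[F]/(F' : _ -> _) -[G]/(G' : _ -> _) [f]mpolyE !raddf_sum.
by apply: eq_bigr => w _; apply: eqFG.
Qed.

Section OreProduct.

Variables (R : idomainType) (n : nat) (D : ore_data R n).
Implicit Types (f g h : {mpoly R[n]}) (w : 'X_{1..n}).

(* Left multiplication by Y_i on the free left R-module on the terms:          *)
(* Y_i * (b w) = alpha_i(b) Y_i w + delta_i(b) w.                              *)
Definition ore_Yact (i : 'I_n) f : {mpoly R[n]} :=
  \sum_(w <- msupp f) (oalpha D i f@_w *: 'X_[U_(i) + w]
                       + odelta D i f@_w *: 'X_[w]).

Definition ore_act w : {mpoly R[n]} -> {mpoly R[n]} :=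
  \big[comp/id]_(i < n) iter (w i) (ore_Yact i).

Definition ore_mul f g : {mpoly R[n]} :=
  \sum_(w <- msupp f) f@_w *: ore_act w g.

Definition alphaT w : R -> R := \big[comp/id]_(i < n) iter (w i) (oalpha D i).

Definition gr_mul f g : {mpoly R[n]} :=
  \sum_(t <- msupp f) \sum_(w <- msupp g)
    (f@_t * alphaT t g@_w) *: 'X_[t + w].

Let YPhi i w a : {mpoly R[n]} :=
  oalpha D i a *: 'X_[U_(i) + w] + odelta D i a *: 'X_[w].

Let YPhiB i w : zmod_morphism (YPhi i w).
Proof. by move=> a b; rewrite /YPhi !raddfB !scalerBl opprD addrACA. Qed.

Lemma ore_YactB i : zmod_morphism (ore_Yact i).
Proof. exact: (msumB (YPhiB i)). Qed.

Lemma ore_Yact_mon i a w : ore_Yact i (a *: 'X_[w]) =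
  oalpha D i a *: 'X_[U_(i) + w] + odelta D i a *: 'X_[w].
Proof. exact: (msum_mon (YPhiB i)). Qed.

HB.instance Definition _ i :=
  GRing.isZmodMorphism.Build {mpoly R[n]} {mpoly R[n]} (ore_Yact i) (ore_YactB i).

Lemma ore_YactZ i a f :
  ore_Yact i (a *: f) = oalpha D i a *: ore_Yact i f + odelta D i a *: f.
Proof.
move: f; apply: additive_ext => [f g|f g|b w].
- by rewrite scalerBr raddfB.
- by rewrite raddfB !scalerBr opprD addrACA.
rewrite scalerA !ore_Yact_mon odeltaM rmorphM scalerDr !scalerA scalerDl addrA.
by [].
Qed.

Lemma ore_YactC i j f : ore_Yact i (ore_Yact j f) = ore_Yact j (ore_Yact i f).
Proof.
have [->//|ij] := eqVneq i j.
move: f; apply: additive_ext => [f g|f g|b w]; rewrite ?raddfB //.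
rewrite !ore_Yact_mon !raddfD /= !ore_Yact_mon.
rewrite [oalpha D j (oalpha D i b)]oalphaC [odelta D j (odelta D i b)]odeltaC.
rewrite (@oalpha_deltaC _ _ D i j) // (@oalpha_deltaC _ _ D j i) 1?eq_sym //.
rewrite !addmA [(U_(j) + U_(i))%MM]addmC -!addrA; congr (_ + _).
by rewrite addrCA.
Qed.

Lemma big_comp_iter (T : Type) (F : 'I_n -> T -> T) (r : seq 'I_n) :
    (forall i j x, F i (F j x) = F j (F i x)) -> uniq r ->
  forall (i : 'I_n) w x,
  (\big[comp/id]_(j <- r) iter ((U_(i) + w)%MM j) (F j)) x =
  if i \in r then F i ((\big[comp/id]_(j <- r) iter (w j) (F j)) x)
  else (\big[comp/id]_(j <- r) iter (w j) (F j)) x.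
Proof.
move=> FC; elim: r => [|k r IH] /=; first by move=> _ i w x; rewrite !big_nil.
case/andP=> kr ur i w x; rewrite !big_cons /= IH // inE mnmDE mnm1E.
have itC l a y : iter a (F k) (F l y) = F l (iter a (F k) y).
  by elim: a => //= a ->; rewrite FC.
have [->|ik] /= := eqVneq i k; first by rewrite (negbTE kr).
by rewrite add0n; case: ifP.
Qed.

Lemma ore_actS i w f : ore_act (U_(i) + w) f = ore_Yact i (ore_act w f).
Proof.
by rewrite /ore_act (big_comp_iter ore_YactC) ?index_enum_uniq ?mem_index_enum.
Qed.

Lemma alphaTS i w a : alphaT (U_(i) + w) a = oalpha D i (alphaT w a).
Proof.
rewrite /alphaT (big_comp_iter (F := fun i => oalpha D i : R -> R)).
- by rewrite mem_index_enum.
- by move=> *; apply: oalphaC.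
- exact: index_enum_uniq.
Qed.

Lemma ore_act0 f : ore_act 0 f = f.
Proof.
rewrite /ore_act; elim: (index_enum _) => [|i r IH]; first by rewrite big_nil.
by rewrite big_cons /= IH mnm0E.
Qed.

Lemma alphaT0 a : alphaT 0 a = a.
Proof.
rewrite /alphaT; elim: (index_enum _) => [|i r IH]; first by rewrite big_nil.
by rewrite big_cons /= IH mnm0E.
Qed.

Lemma mnm_ind (P : 'X_{1..n} -> Prop) :
  P 0%MM -> (forall i w, P w -> P (U_(i) + w)%MM) -> forall w, P w.
Proof.
move=> P0 PS w; have [k] := ubnP (mdeg w); elim: k w => // k IH w.
have [->//|wn0] := eqVneq w 0%MM; rewrite ltnS => lt_w.
have [i wi] : exists i, (0 < w i)%N.
  apply/existsP; apply: contraR wn0 => /existsPn w0; apply/eqP/mnmP => i.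
  by rewrite mnm0E; apply/eqP; rewrite -leqn0 leqNgt w0.
have -> : w = (U_(i) + (w - U_(i)))%MM by rewrite addmC submK // lep1mP -lt0n.
apply/PS/IH; apply: leq_trans lt_w.
rewrite -[X in (_ < mdeg X)%N](@submK _ U_(i)%MM) ?lep1mP -?lt0n //.
by rewrite mdegD mdeg1 addn1.
Qed.

Lemma ore_actB w : zmod_morphism (ore_act w).
Proof.
elim/mnm_ind: w => [|i w IH] f g; first by rewrite !ore_act0.
by rewrite !ore_actS IH raddfB.
Qed.

Lemma alphaTB w : zmod_morphism (alphaT w).
Proof.
elim/mnm_ind: w => [|i w IH] a b; first by rewrite !alphaT0.
by rewrite !alphaTS IH raddfB.
Qed.

Let MPhi g w a : {mpoly R[n]} := a *: ore_act w g.

Let MPhiB g w : zmod_morphism (MPhi g w).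
Proof. by move=> a b; rewrite /MPhi scalerBl. Qed.

Lemma ore_mulBl g : zmod_morphism (ore_mul^~ g).
Proof. exact: (msumB (MPhiB g)). Qed.

Lemma ore_mulBr f : zmod_morphism (ore_mul f).
Proof.
move=> g h; rewrite /ore_mul -sumrB; apply: eq_bigr => w _.
by rewrite ore_actB scalerBr.
Qed.

Lemma ore_mul_mon a w g : ore_mul (a *: 'X_[w]) g = a *: ore_act w g.
Proof. exact: (msum_mon (MPhiB g)). Qed.

Lemma ore_YactM i f g : ore_Yact i (ore_mul f g) = ore_mul (ore_Yact i f) g.
Proof.
move: f; apply: additive_ext => [f h|f h|b w].
- by rewrite ore_mulBl raddfB.
- by rewrite raddfB ore_mulBl.
have addl : {morph ore_mul^~ g : x y / x + y}.
  move=> x y /=; rewrite -[y in LHS]opprK ore_mulBl.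
  have -> : ore_mul (- y) g = - ore_mul y g.
    have h0 : ore_mul 0 g = 0 by have := ore_mulBl g 0 0; rewrite !subrr.
    by rewrite -[- y]sub0r ore_mulBl h0 sub0r.
  by rewrite opprK.
by rewrite ore_mul_mon ore_YactZ ore_Yact_mon addl !ore_mul_mon ore_actS.
Qed.

Lemma ore_actM w f g : ore_act w (ore_mul f g) = ore_mul (ore_act w f) g.
Proof.
elim/mnm_ind: w => [|i w IH]; first by rewrite !ore_act0.
by rewrite !ore_actS IH ore_YactM.
Qed.

Lemma ore_mulZl a f g : ore_mul (a *: f) g = a *: ore_mul f g.
Proof.
move: f; apply: additive_ext => [f h|f h|b w].
- by rewrite scalerBr ore_mulBl.
- by rewrite ore_mulBl scalerBr.
- by rewrite scalerA !ore_mul_mon scalerA.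
Qed.

Lemma ore_mulA : associative ore_mul.
Proof.
move=> f g h; move: f; apply: additive_ext => [f k|f k|b w].
- by rewrite ore_mulBl.
- by rewrite !ore_mulBl.
- by rewrite !ore_mul_mon ore_mulZl ore_actM.
Qed.

Lemma ore_act1 w : ore_act w 1 = 'X_[w].
Proof.
elim/mnm_ind: w => [|i w IH]; first by rewrite ore_act0 mpolyX0.
rewrite ore_actS IH -['X_[w]]scale1r ore_Yact_mon rmorph1 scale1r.
have -> : odelta D i 1 = 0; last by rewrite scale0r addr0.
have := odeltaM D i 1 1; rewrite mulr1 rmorph1 mul1r mulr1 => /eqP.
by rewrite -subr_eq subrr => /eqP.
Qed.

Lemma ore_mul1l : left_id 1 ore_mul.
Proof.
by move=> f; rewrite -mpolyX0 -['X_[0]]scale1r ore_mul_mon scale1r ore_act0.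
Qed.

Lemma ore_mul1r : right_id 1 ore_mul.
Proof.
move=> f; move: f; apply: (additive_ext (G := id)) => [f k|//|b w].
  by rewrite ore_mulBl.
by rewrite ore_mul_mon ore_act1.
Qed.

End OreProduct.

Section GradedProduct.

Variables (R : idomainType) (n : nat) (D : ore_data R n).

Fact gr_deltaM (i : 'I_n) (a b : R) :
  (\0 : {additive R -> R}) (a * b) =
  oalpha D i a * (\0 : {additive R -> R}) b + (\0 : {additive R -> R}) a * b.
Proof. by rewrite /= mulr0 mul0r addr0. Qed.

Fact gr_deltaC (i j : 'I_n) (a : R) :
  (\0 : {additive R -> R}) ((\0 : {additive R -> R}) a) =
  (\0 : {additive R -> R}) ((\0 : {additive R -> R}) a).
Proof. by []. Qed.

Fact gr_alpha_deltaC (i j : 'I_n) (a : R) : i != j ->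
  oalpha D j ((\0 : {additive R -> R}) a) =
  (\0 : {additive R -> R}) (oalpha D j a).
Proof. by move=> _ /=; rewrite rmorph0. Qed.

Definition gr_data : ore_data R n :=
  OreData (@oalpha_inj _ _ D) gr_deltaM (@oalphaC _ _ D) gr_deltaC
    gr_alpha_deltaC.

Lemma gr_act_mon t a w :
  ore_act gr_data t (a *: 'X_[w]) = alphaT D t a *: 'X_[t + w].
Proof.
elim/mnm_ind: t => [|i t IH]; first by rewrite ore_act0 alphaT0 add0m.
by rewrite ore_actS IH ore_Yact_mon /= scale0r addr0 alphaTS addmA.
Qed.

Lemma gr_mulE f g : gr_mul D f g = ore_mul gr_data f g.
Proof.
rewrite /gr_mul /ore_mul; apply: eq_bigr => t _.
have PhiB w : zmod_morphism (fun a => alphaT D t a *: 'X_[t + w] : {mpoly R[n]}).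
  by move=> a b /=; rewrite alphaTB scalerBl.
have -> : ore_act gr_data t g =
    \sum_(w <- msupp g) alphaT D t g@_w *: 'X_[t + w].
  move: g; apply: additive_ext; [exact: ore_actB|exact: (msumB PhiB)|].
  by move=> a w; rewrite gr_act_mon (msum_mon PhiB).
by rewrite scaler_sumr; apply: eq_bigr => w _; rewrite scalerA.
Qed.

End GradedProduct.

(* The multivariate Ore extension R[Y_1;alpha_1,delta_1]...[Y_n;alpha_n,       *)
(* delta_n] and its associated graded Ore extension.  [{mpoly R[n]}] only      *)
(* serves as the free left R-module on the terms ['X_[w]]; its commutative     *)
(* product is replaced by [ore_mul], respectively [gr_mul].                    *)
Definition ore (R : idomainType) n (D : ore_data R n) : Type := {mpoly R[n]}.
Definition gr_ore (R : idomainType) n (D : ore_data R n) : Type := {mpoly R[n]}.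

Section Instances.

Variables (R : idomainType) (n : nat) (D : ore_data R n).

Lemma ore_mulDl : left_distributive (@ore_mul R n D) +%R.
Proof.
move=> f g h; have B := ore_mulBl D h.
have z : ore_mul D 0 h = 0 by have := B 0 0; rewrite !subrr.
by have := B f (- g); rewrite opprK => ->; have := B 0 g; rewrite !sub0r z sub0r
  => ->; rewrite opprK.
Qed.

Lemma ore_mulDr : right_distributive (@ore_mul R n D) +%R.
Proof.
move=> h f g; have B := ore_mulBr D h.
have z : ore_mul D h 0 = 0 by have := B 0 0; rewrite !subrr.
by have := B f (- g); rewrite opprK => ->; have := B 0 g; rewrite !sub0r z sub0r
  => ->; rewrite opprK.
Qed.

Lemma ore_scaleAl (a : R) (f g : {mpoly R[n]}) :
  a *: ore_mul D f g = ore_mul D (a *: f) g.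
Proof. by rewrite ore_mulZl. Qed.

End Instances.

Section GradedInstances.

Variables (R : idomainType) (n : nat) (D : ore_data R n).

Lemma gr_mulA : associative (@gr_mul R n D).
Proof. by move=> f g h; rewrite !gr_mulE ore_mulA. Qed.

Lemma gr_mul1l : left_id 1 (@gr_mul R n D).
Proof. by move=> f; rewrite gr_mulE ore_mul1l. Qed.

Lemma gr_mul1r : right_id 1 (@gr_mul R n D).
Proof. by move=> f; rewrite gr_mulE ore_mul1r. Qed.

Lemma gr_mulDl : left_distributive (@gr_mul R n D) +%R.
Proof. by move=> f g h; rewrite !gr_mulE ore_mulDl. Qed.

Lemma gr_mulDr : right_distributive (@gr_mul R n D) +%R.
Proof. by move=> f g h; rewrite !gr_mulE ore_mulDr. Qed.

Lemma gr_scaleAl (a : R) (f g : {mpoly R[n]}) :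
  a *: gr_mul D f g = gr_mul D (a *: f) g.
Proof. by rewrite !gr_mulE ore_mulZl. Qed.

End GradedInstances.

HB.instance Definition _ (R : idomainType) n (D : ore_data R n) :=
  GRing.Lmodule.copy (ore D) {mpoly R[n]}.
HB.instance Definition _ (R : idomainType) n (D : ore_data R n) :=
  GRing.Zmodule_isNzRing.Build (ore D) (@ore_mulA R n D) (@ore_mul1l R n D)
    (@ore_mul1r R n D) (@ore_mulDl R n D) (@ore_mulDr R n D)
    (oner_neq0 {mpoly R[n]}).
HB.instance Definition _ (R : idomainType) n (D : ore_data R n) :=
  GRing.Lmodule_isLalgebra.Build R (ore D) (@ore_scaleAl R n D).

HB.instance Definition _ (R : idomainType) n (D : ore_data R n) :=
  GRing.Lmodule.copy (gr_ore D) {mpoly R[n]}.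
HB.instance Definition _ (R : idomainType) n (D : ore_data R n) :=
  GRing.Zmodule_isNzRing.Build (gr_ore D) (@gr_mulA R n D) (@gr_mul1l R n D)
    (@gr_mul1r R n D) (@gr_mulDl R n D) (@gr_mulDr R n D)
    (oner_neq0 {mpoly R[n]}).
HB.instance Definition _ (R : idomainType) n (D : ore_data R n) :=
  GRing.Lmodule_isLalgebra.Build R (gr_ore D) (@gr_scaleAl R n D).

Section Monomials.

Variables (R : idomainType) (n : nat) (D : ore_data R n).

Definition ore_mon (a : R) (w : 'X_{1..n}) : ore D := a *: 'X_[w].
Definition gr_mon (a : R) (w : 'X_{1..n}) : gr_ore D := a *: 'X_[w].
Definition ore_Y (i : 'I_n) : ore D := ore_mon 1 U_(i).

Lemma ore_YC i (r : R) :
  ore_Y i * r%:A = (oalpha D i r)%:A * ore_Y i + (odelta D i r)%:A.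
Proof.
have one : (1 : ore D) = 'X_[0] :> {mpoly R[n]} by rewrite mpolyX0.
rewrite -[in RHS]scalerAl mul1r [LHS]ore_mul_mon scale1r -[U_(i)%MM in LHS]addm0.
rewrite ore_actS ore_act0 one [LHS]ore_Yact_mon addm0.
by rewrite [ore_Y i]scale1r.
Qed.

Lemma ore_YmonS i w : ore_Y i * ore_mon 1 w = ore_mon 1 (U_(i) + w).
Proof.
rewrite [LHS]ore_mul_mon scale1r -[U_(i)%MM in LHS]addm0 ore_actS ore_act0.
rewrite [ore_mon 1 w]scale1r -[in LHS](ore_act1 D) -ore_actS ore_act1.
by rewrite [RHS]scale1r.
Qed.

Lemma ore_YYC i j : ore_Y i * ore_Y j = ore_Y j * ore_Y i.
Proof. by rewrite !ore_YmonS addmC. Qed.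

Lemma ore_monE a w : ore_mon a w = a *: \prod_(i < n) ore_Y i ^+ w i.
Proof.
suff -> : \prod_(i < n) ore_Y i ^+ w i = ore_mon 1 w.
  by rewrite [RHS]scalerA mulr1.
have powE i k v : ore_Y i ^+ k * ore_mon 1 v = ore_mon 1 (U_(i) *+ k + v).
  elim: k => [|k IH]; first by rewrite expr0 mul1r mulm0n add0m.
  by rewrite exprS -mulrA IH ore_YmonS addmA mulmS.
rewrite [w in RHS](multinomUE_id w).
elim: (index_enum _) => [|i r IH].
  by rewrite !big_nil [RHS]scale1r mpolyX0.
by rewrite !big_cons IH powE.
Qed.

Lemma gr_monM a b t w :
  gr_mon a t * gr_mon b w = gr_mon (a * alphaT D t b) (t + w).
Proof.
by rewrite [LHS]gr_mulE [LHS]ore_mul_mon gr_act_mon scalerA.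
Qed.

End Monomials.

Definition well_ordering (T : eqType) (lt : rel T) : Prop :=
  [/\ irreflexive lt, transitive lt,
      forall x y, x != y -> lt x y || lt y x & well_founded lt].

Definition term_ordering n (prec : rel 'X_{1..n}) : Prop :=
  well_ordering prec /\
  forall w t1 t2, prec t1 t2 -> prec (w + t1)%MM (w + t2)%MM.

(* The term t e_i of the free module of rank m. *)
Definition vterm (n m : nat) : Type := 'X_{1..n} * 'I_m.

Definition tmul n m (w : 'X_{1..n}) (t : vterm n m) : vterm n m :=
  ((w + t.1)%MM, t.2).

Definition compatible_term_ordering n m (prec : rel 'X_{1..n})
    (lt : rel (vterm n m)) : Prop :=
  [/\ well_ordering lt,
      forall w1 w2 t, prec w1 w2 -> lt (tmul w1 t) (tmul w2 t)
    & forall w t1 t2, lt t1 t2 -> lt (tmul w t1) (tmul w t2)].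

Definition seq_max (T : Type) (lt : rel T) (x0 : T) (s : seq T) : T :=
  if s is x :: s' then foldl (fun y z => if lt y z then z else y) x s' else x0.

Section Groebner.

Variables (R : idomainType) (n m : nat) (D : ore_data R n).
Variables (prec : rel 'X_{1..n}) (lt : rel (vterm n m.+1)).

Local Notation vec := 'rV[ore D]_m.+1.
Local Notation grvec := 'rV[gr_ore D]_m.+1.

(* The values of [oT], [vT], [vlc] and [vM] at 0 are irrelevant. *)
Definition oT (l : ore D) : 'X_{1..n} := seq_max prec 0%MM (msupp l).

Definition vsupp (f : vec) : seq (vterm n m.+1) :=
  [seq (w, i) | i <- enum 'I_m.+1, w <- msupp (f 0 i)].

Definition vT (f : vec) : vterm n m.+1 := seq_max lt (0%MM, ord0) (vsupp f).

Definition vlc (f : vec) : R := mcoeff (vT f).1 (f 0 (vT f).2).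

(* M(f), seen in the free module over the graded extension. *)
Definition vM (f : vec) : grvec :=
  gr_mon D (vlc f) (vT f).1 *: delta_mx 0 (vT f).2.

Variables (u : nat) (g : 'I_u -> vec).

Definition left_span (f : vec) : Prop :=
  exists l : 'I_u -> ore D, f = \sum_i l i *: g i.

Definition left_groebner_basis : Prop :=
  forall f : vec, left_span f -> f != 0 ->
    exists k (a : 'I_k -> R) (lam : 'I_k -> 'X_{1..n}) (j : 'I_k -> 'I_u),
      [/\ forall i, a i != 0,
          forall i, tmul (lam i) (vT (g (j i))) = vT f
        & vM f = \sum_i gr_mon D (a i) (lam i) *: vM (g (j i))].

Definition left_groebner_representation (f : vec) : Prop :=
  f = 0 \/
  exists2 l : 'I_u -> ore D, f = \sum_i l i *: g i
    & forall i, l i != 0 ->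
        let t := tmul (oT (l i)) (vT (g i)) in (t == vT f) || lt t (vT f).

(* The map s_L, from the free graded module with basis e_1, ..., e_u. *)
Definition syz_map (h : 'rV[gr_ore D]_u) : grvec := \sum_i h 0 i *: vM (g i).

Definition homogeneous (h : 'rV[gr_ore D]_u) : Prop :=
  exists (a : 'I_u -> R) (lam : 'I_u -> 'X_{1..n}),
    h = \sum_i gr_mon D (a i) (lam i) *: delta_mx 0 i /\
    forall i j, a i != 0 -> a j != 0 ->
      tmul (lam i) (vT (g i)) = tmul (lam j) (vT (g j)).

Definition gebauer_moeller_set (G : 'rV[gr_ore D]_u -> Prop) : Prop :=
  (forall h, G h -> homogeneous h) /\
  forall h, syz_map h = 0 <->
    exists k (s : 'I_k -> gr_ore D) (v : 'I_k -> 'rV[gr_ore D]_u),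
      (forall i, G (v i)) /\ h = \sum_i s i *: v i.

Definition same_component (i j : 'I_u) : bool := (vT (g i)).2 == (vT (g j)).2.

Definition pair_term (i j : 'I_u) : 'X_{1..n} :=
  mlcm (vT (g i)).1 (vT (g j)).1.

(* tau(i,j) / tau_i *)
Definition pair_cofactor (i j : 'I_u) : 'X_{1..n} :=
  (pair_term i j - (vT (g i)).1)%MM.

(* a_ij *)
Definition pair_coef (i j : 'I_u) : R :=
  alphaT D (pair_cofactor i j) (vlc (g i)).

Definition is_lcm (a b c : R) : Prop :=
  [/\ exists x, c = x * a, exists y, c = y * b
    & forall d, (exists x, d = x * a) -> (exists y, d = y * b) ->
        exists z, d = z * c].

(* c / a, for a nonzero divisor a of c. *)
Definition exact_quo (c a : R) : R :=
  epsilon (inhabits 0) (fun q => c = q * a).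

(* In a principal ideal domain lcms are only determined up to a unit, so       *)
(* c(i,j) is a parameter, any choice of lcms being allowed.                    *)
Variable c : 'I_u -> 'I_u -> R.

Definition lcm_choice : Prop :=
  forall i j : 'I_u, (i < j)%N -> same_component i j ->
    is_lcm (pair_coef i j) (pair_coef j i) (c i j).

Definition spair_syz (i j : 'I_u) : 'rV[gr_ore D]_u :=
  gr_mon D (exact_quo (c i j) (pair_coef j i)) (pair_cofactor j i)
    *: delta_mx 0 j
  - gr_mon D (exact_quo (c i j) (pair_coef i j)) (pair_cofactor i j)
    *: delta_mx 0 i.

Definition spoly (i j : 'I_u) : vec :=
  ore_mon D (exact_quo (c i j) (pair_coef j i)) (pair_cofactor j i) *: g j
  - ore_mon D (exact_quo (c i j) (pair_coef i j)) (pair_cofactor i j) *: g i.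

(* The pair {i,j}, i < j, is encoded as (i, j). *)
Definition useful_spair_set (GM : {set 'I_u * 'I_u}) : Prop :=
  (forall i j : 'I_u, (i, j) \in GM -> (i < j)%N /\ same_component i j) /\
  gebauer_moeller_set
    (fun h => exists i j : 'I_u, (i, j) \in GM /\ h = spair_syz i j).

End Groebner.

(* Main.v *)
(* Give the monomial w e_i of the free module on e_1, ..., e_u the weight      *)
(* w T(g_i).  Left multiplication by a term agrees with the graded one up to   *)
(* terms of smaller weight, so if a row l has weights at most t, the           *)
(* coefficient of t in sum_i l_i g_i is that of s_L of the part of l of weight *)
(* t.  If this coefficient vanishes, that part is a syzygy, hence a sum of     *)
(* monomial multiples of the b(i,j), and the representations of the B(i,j)     *)
(* replace l by a row of weights below t; as < is a well-ordering, this ends   *)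
(* with weights at most T(f).  Conversely, subtracting from f in M the         *)
(* combination given by the definition of a Groebner basis lowers T(f).        *)

From HB Require Import structures.
Require Import Defs.
From mathcomp Require Import all_boot all_order all_algebra.
From mathcomp Require Import mpoly.

Set Implicit Arguments.
Unset Strict Implicit.
Unset Printing Implicit Defensive.

Import GRing.Theory.
Local Open Scope ring_scope.

(** Everything rests on comparing [ore D] with [gr_ore D] at the top weight. Multiplying by a term
    on the left gives the graded product plus smaller terms only ([msupp_ore_act_gr]), so for a row
    of weights at most t the coefficient of t in its combination is the one computed by s_L
    ([vcoef_lincomb], [syz_mapE]). If that coefficient vanishes, the top part of the row is a
    homogeneous syzygy of the M(g_i). Written in a Gebauer-Moeller set, it lifts, up to smaller
    weights, to multiples of S-polynomials, whose representations stay below t ([reducible_gr_act],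
    [reducible_syzygy], [reducible_cancel]). Well-founded descent then gives every nonzero f in the
    module a row bounded by T(f) ([groebner_row]), and the coefficient of T(f) exhibits M(f) as a
    combination of the M(g_i). Conversely, a Groebner basis represents every element of the module
    by division ([representation_of_groebner_basis]), S-polynomials included. *)

Section SeqMax.

Variables (T : eqType) (lt : rel T) (lt_wo : well_ordering lt).

Lemma seq_max_mem x0 s : s != [::] -> seq_max lt x0 s \in s.
Proof.
case: s => //= x s _; elim: s x => [|y s IH] x /=; first by rewrite mem_head.
by case: ifP => _; have := IH x; have := IH y; rewrite !inE;
  [move=> /orP[]->|move=> _ /orP[]->]; rewrite ?orbT.
Qed.

Lemma seq_max_ge x0 s y :
  y \in s -> (y == seq_max lt x0 s) || lt y (seq_max lt x0 s).
Proof.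
have [_ lt_trans lt_total _] := lt_wo.
have le_trans a b d : (a == b) || lt a b -> (b == d) || lt b d ->
    (a == d) || lt a d.
  move=> /predU1P[->//|ab] /predU1P[<-|bd]; first by rewrite ab orbT.
  by rewrite (lt_trans _ _ _ ab bd) orbT.
case: s => //= x s; elim: s x y => [|z s IH] x y /=.
  by rewrite inE => ->.
have ge_acc: y \in [:: x; z] ->
    (y == (if lt x z then z else x)) || lt y (if lt x z then z else x).
  rewrite !inE => /pred2P[]->; case: ifP => xz; rewrite ?eqxx ?xz ?orbT //.
  by have [//|zx] := eqVneq z x; have := lt_total _ _ zx; rewrite xz orbF.
rewrite !inE orbA => /orP[yxz|ys]; last by apply: IH; rewrite inE ys orbT.
by apply: le_trans (IH _ _ (mem_head _ _)); apply: ge_acc; rewrite !inE.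
Qed.

End SeqMax.

(** * Term orderings, and Ore multiplication against graded multiplication *)

Section Weights.

Variables (R : idomainType) (n m : nat) (D : ore_data R n).
Variables (prec : rel 'X_{1..n}) (lt : rel (vterm n m.+1)).
Hypothesis hprec : term_ordering prec.
Hypothesis hlt : compatible_term_ordering prec lt.

Local Notation P := {mpoly R[n]}.
Local Notation term := (vterm n m.+1).
Local Notation gr_act := (ore_act (gr_data D)).

Let le (s t : term) := (s == t) || lt s t.

Lemma term_lt_trans : transitive lt.
Proof. by have [[]] := hlt. Qed.

Lemma term_le_trans s t r : le s t -> le t r -> le s r.
Proof.
move=> /predU1P[->//|st] /predU1P[<-|tr]; first by rewrite /le st orbT.
by rewrite /le (term_lt_trans st tr) orbT.
Qed.

Lemma term_le_lt_trans s t r : le s t -> lt t r -> lt s r.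
Proof. by move=> /predU1P[->//|]; apply: term_lt_trans. Qed.

Lemma tmulA w1 w2 (t : term) : tmul (w1 + w2) t = tmul w1 (tmul w2 t).
Proof. by rewrite /tmul /= addmA. Qed.

Lemma tmul_le w s t : le s t -> le (tmul w s) (tmul w t).
Proof.
have [_ _ ltM] := hlt.
by move=> /predU1P[->|/(ltM w)]; rewrite /le ?eqxx // => ->; rewrite orbT.
Qed.

(* A variable below 1 would give the infinite descending chain of its multiples. *)
Lemma prec0U i : prec 0%MM U_(i)%MM.
Proof.
have [[irr tr tot wf] compat] := hprec.
have neq0 : 0%MM != U_(i)%MM :> 'X_{1..n}.
  by apply/eqP => /(congr1 (fun w : 'X_{1..n} => w i)); rewrite mnm0E mnm1E eqxx.
case/orP: (tot _ _ neq0) => // neg.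
have desc k : ~ exists q, k = (U_(i) *+ q)%MM.
  elim/(well_founded_ind wf): k => k IH [q kE].
  apply: (IH (U_(i) *+ q.+1)%MM); last by exists q.+1.
  by rewrite kE mulmS -[X in prec _ X]addm0 addmC; apply: compat.
by case: (desc 0%MM); exists 0%N; rewrite mulm0n.
Qed.

Lemma gr_actE w (f : P) :
  gr_act w f = \sum_(v <- msupp f) alphaT D w f@_v *: 'X_[w + v].
Proof.
have PhiB v : zmod_morphism (fun a => alphaT D w a *: 'X_[w + v] : P).
  by move=> a b /=; rewrite alphaTB scalerBl.
move: f; apply: additive_ext; [exact: ore_actB|exact: (msumB PhiB)|].
by move=> a v; rewrite gr_act_mon (msum_mon PhiB).
Qed.

Lemma mem_msupp_sum (I : eqType) (r : seq I) (F : I -> P) x :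
  x \in msupp (\sum_(i <- r) F i) -> exists2 i, i \in r & x \in msupp (F i).
Proof.
elim: r => [|i r IH]; first by rewrite big_nil msupp0.
rewrite big_cons => /msuppD_le; rewrite mem_cat => /orP[xi|/IH[j jr xj]].
  by exists i; rewrite ?mem_head.
by exists j => //; rewrite inE jr orbT.
Qed.

Lemma mem_msuppZX a v x : x \in msupp (a *: 'X_[v] : P) -> x = v.
Proof. by move=> /msuppZ_le; rewrite msuppX inE => /eqP. Qed.

Lemma msupp_gr_act w (f : P) x :
  x \in msupp (gr_act w f) -> exists2 v, v \in msupp f & x = (w + v)%MM.
Proof.
by rewrite gr_actE => /mem_msupp_sum[v vf /mem_msuppZX ->]; exists v.
Qed.

Lemma msupp_ore_Yact i (f : P) x : x \in msupp (ore_Yact D i f) ->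
  exists2 v, v \in msupp f & x = (U_(i) + v)%MM \/ x = v.
Proof.
move=> /mem_msupp_sum[v vf] /msuppD_le; rewrite mem_cat.
by case/orP=> /mem_msuppZX ->; exists v; auto.
Qed.

(** The two actions differ by the delta_i part alone, which moves no term. *)
Lemma msupp_ore_Yact_gr i (f : P) x :
  x \in msupp (ore_Yact D i f - ore_Yact (gr_data D) i f) -> x \in msupp f.
Proof.
rewrite /ore_Yact -sumrB => /mem_msupp_sum[v vf]; rewrite /= scale0r addr0.
by rewrite addrAC subrr add0r => /mem_msuppZX ->.
Qed.

(** By induction on w: one more Y_i multiplies the earlier error terms by Y_i or leaves them in
    place, and adds the delta_i error of the graded part, for which w' is the old w, smaller than
    Y_i w. *)
Lemma msupp_ore_act_gr w (f : P) x :
  x \in msupp (ore_act D w f - gr_act w f) ->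
  exists v w', [/\ v \in msupp f, prec w' w & x = (w' + v)%MM].
Proof.
have [[_ tr _ _] compat] := hprec.
have ltU i w' : prec w' (U_(i) + w')%MM.
  by rewrite -[X in prec X]add0m ![(_ + w')%MM]addmC; apply/compat/prec0U.
elim/mnm_ind: w x => [|i w IH] x; first by rewrite !ore_act0 subrr msupp0.
rewrite !ore_actS.
set a := ore_act D w f; set b := gr_act w f.
have -> : ore_Yact D i a - ore_Yact (gr_data D) i b =
    ore_Yact D i (a - b) + (ore_Yact D i b - ore_Yact (gr_data D) i b).
  by rewrite raddfB addrA subrK.
move=> /msuppD_le; rewrite mem_cat => /orP[/msupp_ore_Yact[y]|].
  case/IH=> [v [w' [vf ww ->]]] [] ->; exists v.
    by exists (U_(i) + w')%MM; split=> //; [apply: compat|rewrite addmA].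
  by exists w'; split=> //; apply: tr ww (ltU _ _).
by move=> /msupp_ore_Yact_gr/msupp_gr_act[v vf ->]; exists v, w; split.
Qed.

(** * Rows of coefficients and their weights *)

Section WeightedRows.

Variables (k : nat) (beta : 'I_k -> term).
Implicit Type l : 'I_k -> P.

(** With [beta] the heads T(g_i) this measures a row of coefficients; with [beta] the basis vectors,
    as in [vec_le], it bounds the terms of a vector. *)
Definition weights_in (Q : pred term) l : Prop :=
  forall i w, w \in msupp (l i) -> Q (tmul w (beta i)).

Lemma weights_inW (Q Q' : pred term) l :
  subpred Q Q' -> weights_in Q l -> weights_in Q' l.
Proof. by move=> QQ' lQ i w /lQ/QQ'. Qed.

Lemma weights_in0 Q : weights_in Q (fun _ => 0).
Proof. by move=> i w; rewrite msupp0. Qed.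

Lemma weights_inD Q l1 l2 : weights_in Q l1 -> weights_in Q l2 ->
  weights_in Q (fun i => l1 i + l2 i).
Proof.
by move=> l1Q l2Q i w /msuppD_le; rewrite mem_cat => /orP[/l1Q|/l2Q].
Qed.

Lemma weights_inN Q l : weights_in Q l -> weights_in Q (fun i => - l i).
Proof. by move=> lQ i w; rewrite (perm_mem (msuppN _)) => /lQ. Qed.

Lemma weights_in_gr_act w t a l : weights_in (pred1 t) l ->
  weights_in (pred1 (tmul w t)) (fun i => a *: gr_act w (l i)).
Proof.
move=> lt_ i x /msuppZ_le/msupp_gr_act[v /lt_/eqP<- ->] /=.
by rewrite tmulA.
Qed.

(** An error term w' v with w' below w has weight at most w' t, and w' t < w t because the two
    orderings are compatible. *)
Lemma weights_in_ore_act_gr w t a l : weights_in (le^~ t) l ->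
  weights_in (lt^~ (tmul w t))
    (fun i => a *: ore_act D w (l i) - a *: gr_act w (l i)).
Proof.
have [_ precM _] := hlt.
move=> l_le i x; rewrite -scalerBr => /msuppZ_le.
case/msupp_ore_act_gr=> [v [w' [/l_le vt ww ->]]]; rewrite tmulA.
exact: term_le_lt_trans (tmul_le w' vt) (precM _ _ _ ww).
Qed.

Lemma weights_in_ore_act_lt w t a l : weights_in (lt^~ t) l ->
  weights_in (lt^~ (tmul w t)) (fun i => a *: ore_act D w (l i)).
Proof.
have [_ _ ltM] := hlt.
move=> l_lt.
have l_le : weights_in (le^~ t) l.
  by apply: weights_inW l_lt => s /= st; rewrite /le st orbT.
have lt_gr : weights_in (lt^~ (tmul w t)) (fun i => a *: gr_act w (l i)).
  by move=> i x /msuppZ_le/msupp_gr_act[v /l_lt vt ->]; rewrite tmulA; apply: ltM.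
move=> i x; have := weights_inD (weights_in_ore_act_gr (w := w) (a := a) l_le) lt_gr.
by move/(_ i x); rewrite subrK.
Qed.

Lemma weights_in_ore_act_le w t a l : weights_in (le^~ t) l ->
  weights_in (le^~ (tmul w t)) (fun i => a *: ore_act D w (l i)).
Proof.
move=> l_le.
have le_gr : weights_in (le^~ (tmul w t)) (fun i => a *: gr_act w (l i)).
  move=> i x /msuppZ_le/msupp_gr_act[v /l_le vt ->]; rewrite tmulA.
  exact: tmul_le.
have lt_le : subpred (lt^~ (tmul w t)) (le^~ (tmul w t)).
  by move=> s /= st; rewrite /le st orbT.
move=> i x; have := weights_inD (weights_inW lt_le
  (weights_in_ore_act_gr (w := w) (a := a) l_le)) le_gr.
by move/(_ i x); rewrite subrK.
Qed.

(** The bound is attained by a monomial of the row, which is what makes it drop strictly after each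
    reduction in [groebner_row]. *)
Lemma weights_in_max l : (exists i, l i != 0) ->
  exists i w, w \in msupp (l i) /\ weights_in (le^~ (tmul w (beta i))) l.
Proof.
have [lt_wo _ _] := hlt.
case=> i0 li0; pose s := [seq tmul w (beta i) | i <- enum 'I_k, w <- msupp (l i)].
have mem_s i w : w \in msupp (l i) -> tmul w (beta i) \in s.
  move=> wl; apply/allpairsPdep; exists i, w; split=> //.
  by rewrite mem_enum.
have s_neq0 : s != [::].
  move: li0; rewrite -msupp_eq0; case E: (msupp (l i0)) => [//|w r] _.
  by have := mem_s i0 w; rewrite E mem_head => /(_ isT); case: (s).
have /allpairsPdep[i [w [_ wl sE]]] := seq_max_mem lt (beta i0) s_neq0.
exists i, w; rewrite -sE; split=> // i' w' /mem_s.
exact: seq_max_ge.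
Qed.

End WeightedRows.

Lemma mcoeff_gr_act w (f : P) v : (gr_act w f)@_(w + v) = alphaT D w f@_v.
Proof.
move: f; apply: additive_ext => [f h|f h|a x] /=.
- by rewrite ore_actB mcoeffB.
- by rewrite mcoeffB alphaTB.
rewrite gr_act_mon !mcoeffZ !mcoeffX eqm_add2l.
case: eqP; rewrite ?mulr1 // !mulr0.
by have := alphaTB D w 0 0; rewrite !subrr.
Qed.

(** * Terms and coefficients of vectors *)

Section Rows.

Local Notation vec := 'rV[ore D]_m.+1.
Implicit Types (f : vec) (t : term).

Definition entry f : 'I_m.+1 -> P := fun i => f 0 i.
Definition vcoef t f : R := (entry f t.2)@_t.1.
Definition vec_le t f := weights_in (fun i => (0%MM, i)) (le^~ t) (entry f).

Lemma entryD f h i : entry (f + h) i = entry f i + entry h i.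
Proof. by rewrite /entry mxE. Qed.

Lemma entry_monZ a w f i :
  entry (ore_mon D a w *: f) i = a *: ore_act D w (entry f i).
Proof. by rewrite /entry mxE [LHS]ore_mul_mon. Qed.

Lemma vcoefB t : zmod_morphism (vcoef t).
Proof. by move=> f h; rewrite /vcoef /entry !mxE; apply: mcoeffB. Qed.

HB.instance Definition _ t :=
  GRing.isZmodMorphism.Build vec R (vcoef t) (vcoefB t).

Lemma vec_le0 t : vec_le t 0.
Proof. by move=> i w; rewrite /entry mxE msupp0. Qed.

Lemma vec_leD t f h : vec_le t f -> vec_le t h -> vec_le t (f + h).
Proof.
move=> f_le h_le i w; rewrite entryD => wfh.
exact: (weights_inD f_le h_le) wfh.
Qed.

Lemma vec_leN t f : vec_le t f -> vec_le t (- f).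
Proof.
move=> f_le i w; have -> : entry (- f) i = - entry f i by rewrite /entry mxE.
by rewrite (perm_mem (msuppN _)) => /f_le.
Qed.

Lemma vec_leW s t f : le s t -> vec_le s f -> vec_le t f.
Proof. by move=> st; apply: weights_inW => r rs; apply: term_le_trans st. Qed.

Lemma vec_le_monZ t a w f : vec_le t f -> vec_le (tmul w t) (ore_mon D a w *: f).
Proof.
move=> f_le i x; rewrite entry_monZ; exact: (weights_in_ore_act_le f_le).
Qed.

(** The contributions of the delta_i lie strictly below w t, so at w t the product is the graded
    one. *)
Lemma vcoef_monZ t a w f : vec_le t f ->
  vcoef (tmul w t) (ore_mon D a w *: f) = a * alphaT D w (vcoef t f).
Proof.
have [[irr _ _ _] _ _] := hlt.
move=> f_le; rewrite /vcoef entry_monZ /= -mcoeff_gr_act -mcoeffZ.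
apply/eqP; rewrite -subr_eq0 -mcoeffB; apply/negPn/negP.
rewrite -mcoeff_msupp => /(weights_in_ore_act_gr f_le).
by rewrite /tmul /= addm0 irr.
Qed.

Lemma vcoef_eq0 s t f : vec_le s f -> lt s t -> vcoef t f = 0.
Proof.
have [[irr tr _ _] _ _] := hlt.
move=> f_le st; apply/eqP/negPn/negP; rewrite -mcoeff_msupp => /f_le.
rewrite /tmul /= addm0 -surjective_pairing => /term_le_lt_trans/(_ st).
by rewrite irr.
Qed.

Lemma vec_eq0_coef f : (forall t, vcoef t f = 0) -> f = 0.
Proof.
move=> f0; apply/rowP => i; rewrite mxE.
by apply/(mpolyP (f 0 i : P)) => w; rewrite mcoeff0; apply: (f0 (w, i)).
Qed.

Lemma mem_vsupp f t : (t \in vsupp f) = (vcoef t f != 0).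
Proof.
rewrite -mcoeff_msupp; case: t => w i /=; apply/allpairsPdep/idP.
  by move=> [j [v [_ vf [-> ->]]]].
by move=> wf; exists i, w; rewrite mem_enum.
Qed.

Lemma vec_le_vT f : vec_le (vT lt f) f.
Proof.
have [lt_wo _ _] := hlt.
move=> i w wf; rewrite /tmul /= addm0; apply: seq_max_ge => //.
by rewrite mem_vsupp -mcoeff_msupp.
Qed.

Lemma vlc_neq0 f : f != 0 -> vcoef (vT lt f) f != 0.
Proof.
move=> f0; rewrite -mem_vsupp; apply: seq_max_mem.
apply: contra_neq f0 => f0; apply: vec_eq0_coef => t.
by apply/eqP/negPn; rewrite -mem_vsupp f0.
Qed.

Lemma vT_le t f : f != 0 -> vec_le t f -> le (vT lt f) t.
Proof.
move=> /vlc_neq0; rewrite -mcoeff_msupp => fT f_le.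
by have := f_le _ _ fT; rewrite /tmul /= addm0 -surjective_pairing.
Qed.

Lemma vT_lt t f : f != 0 -> vec_le t f -> vcoef t f = 0 -> lt (vT lt f) t.
Proof.
move=> f0 f_le ft; case/predU1P: (vT_le f0 f_le) => // fT.
by move: (vlc_neq0 f0); rewrite fT ft eqxx.
Qed.

(** * Combinations of the generators and their leading coefficients *)

Variables (u : nat) (g : 'I_u -> vec).
Implicit Type l : 'I_u -> P.
Local Notation head i := (vT lt (g i)).
Local Notation row_in := (weights_in (fun i => head i)).

(** Rows have bare polynomial entries, so that a syzygy over [gr_ore D] can be read, with the same
    coefficients, as a combination over [ore D]. *)
Definition lincomb l : vec := \sum_i (l i : ore D) *: g i.

Lemma eq_lincomb l l' : l =1 l' -> lincomb l = lincomb l'.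
Proof. by move=> ll'; apply: eq_bigr => i _; rewrite ll'. Qed.

Lemma lincomb0 : lincomb (fun _ => 0) = 0.
Proof. by rewrite /lincomb big1 // => i _; apply: scale0r. Qed.

Lemma lincombD l l' : lincomb (fun i => l i + l' i) = lincomb l + lincomb l'.
Proof. by rewrite /lincomb -big_split /=; apply: eq_bigr => i _; apply: scalerDl. Qed.

Lemma lincombN l : lincomb (fun i => - l i) = - lincomb l.
Proof. by rewrite /lincomb -sumrN; apply: eq_bigr => i _; apply: scaleNr. Qed.

Lemma lincomb_monZ a w l :
  lincomb (fun i => a *: ore_act D w (l i)) = ore_mon D a w *: lincomb l.
Proof.
rewrite /lincomb scaler_sumr; apply: eq_bigr => i _; rewrite scalerA.
by congr (_ *: _); rewrite -ore_mul_mon.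
Qed.

Lemma lincomb_monE l : lincomb l =
  \sum_i \sum_(w <- msupp (l i)) ore_mon D (l i)@_w w *: g i.
Proof.
apply: eq_bigr => i _; rewrite -scaler_suml; congr (_ *: _).
exact: mpolyE.
Qed.

(* The coefficient at [t] of the image under s_L. *)
Definition lead t l : R := \sum_i \sum_(w <- msupp (l i))
  (if tmul w (head i) == t then (l i)@_w * alphaT D w (vlc lt (g i)) else 0).

Lemma vec_le_lincomb t l : row_in (le^~ t) l -> vec_le t (lincomb l).
Proof.
move=> l_le; rewrite lincomb_monE.
apply: big_ind => [|f h|i _]; [exact: vec_le0|exact: vec_leD|].
rewrite big_seq; apply: big_ind => [|f h|w /l_le wt].
- exact: vec_le0.
- exact: vec_leD.
- by apply: (vec_leW wt); apply/vec_le_monZ/vec_le_vT.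
Qed.

(** Monomials of weight t contribute as in [vcoef_monZ]; those of smaller weight do not reach t. *)
Lemma vcoef_lincomb t l : row_in (le^~ t) l -> vcoef t (lincomb l) = lead t l.
Proof.
move=> l_le; rewrite lincomb_monE raddf_sum; apply: eq_bigr => i _ /=.
rewrite raddf_sum !big_seq; apply: eq_bigr => w /l_le wt /=.
case: eqP => [<-|/eqP wt']; first exact/vcoef_monZ/vec_le_vT.
have mon_le : vec_le (tmul w (head i)) (ore_mon D (l i)@_w w *: g i).
  exact/vec_le_monZ/vec_le_vT.
apply: vcoef_eq0 mon_le _.
by case/predU1P: wt => // wt; rewrite wt eqxx in wt'.
Qed.

Lemma syz_mapE (h : 'rV[gr_ore D]_u) t :
  (syz_map lt g h 0 t.2 : P)@_t.1 = lead t (fun i => h 0 i).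
Proof.
have coefD : {morph (fun f : 'rV[gr_ore D]_m.+1 => (f 0 t.2 : P)@_t.1) :
    x y / x + y} by move=> x y; rewrite mxE; apply: mcoeffD.
have coef0 : ((0 : 'rV[gr_ore D]_m.+1) 0 t.2 : P)@_t.1 = 0.
  by rewrite mxE; apply: mcoeff0.
rewrite /syz_map (big_morph _ coefD coef0); apply: eq_bigr => i _.
have {1}-> : h 0 i = \sum_(w <- msupp (h 0 i : P)) gr_mon D (h 0 i : P)@_w w.
  exact: mpolyE.
rewrite scaler_suml (big_morph _ coefD coef0); apply: eq_bigr => w _.
rewrite /vM scalerA gr_monM !mxE /= eq_sym.
rewrite /tmul [X in _ = if X then _ else _]xpair_eqE /=.
case: (eqVneq (vT lt (g i)).2 t.2) => [E|E] /=.
  rewrite mulr1 andbT; rewrite [LHS]mcoeffZ mcoeffX.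
  by case: ifP => _; rewrite ?mulr1 ?mulr0.
by rewrite mulr0 andbF; apply: mcoeff0.
Qed.

(** Turns an identity between maximal monomials into an identity in R; it serves both directions of
    the theorem. *)
Lemma sum_head_monomials t (I : Type) (r : seq I) (p : pred I)
    (a : I -> R) (lam : I -> 'X_{1..n}) (j : I -> 'I_u) :
  (forall q, p q -> tmul (lam q) (head (j q)) = t) ->
  \sum_(q <- r | p q) gr_mon D (a q) (lam q) *: vM lt (g (j q)) =
  gr_mon D (\sum_(q <- r | p q) a q * alphaT D (lam q) (vlc lt (g (j q)))) t.1
    *: delta_mx 0 t.2.
Proof.
move=> lam_t.
have -> : gr_mon D (\sum_(q <- r | p q)
      a q * alphaT D (lam q) (vlc lt (g (j q)))) t.1 =
    \sum_(q <- r | p q)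
      gr_mon D (a q * alphaT D (lam q) (vlc lt (g (j q)))) t.1.
  exact: scaler_suml.
rewrite scaler_suml; apply: eq_bigr => q /lam_t <-.
by rewrite /vM scalerA gr_monM.
Qed.

Lemma gr_mon_delta_inj (t : term) :
  injective (fun a => gr_mon D a t.1 *: delta_mx 0 t.2 : 'rV_m.+1).
Proof.
move=> a b /rowP/(_ t.2); rewrite !mxE !eqxx !mulr1.
move=> /(congr1 (fun f : P => f@_t.1)).
by rewrite !mcoeffZ mcoeffX eqxx !mulr1.
Qed.

(** * Homogeneous components of rows *)

Definition wpart t l i : P :=
  \sum_(w <- msupp (l i) | tmul w (head i) == t) (l i)@_w *: 'X_[w].

Lemma mcoeff_wpart t l i w :
  (wpart t l i)@_w = if tmul w (head i) == t then (l i)@_w else 0.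
Proof.
pose Phi v a : P := if tmul v (head i) == t then a *: 'X_[v] else 0.
have PhiB v : zmod_morphism (Phi v).
  by move=> a b; rewrite /Phi; case: ifP => _; rewrite ?scalerBl ?subr0.
rewrite /wpart big_mkcond; move: (l i); apply: additive_ext => [f h|f h|a v].
- by rewrite (msumB PhiB) mcoeffB.
- by rewrite mcoeffB; case: ifP; rewrite ?subr0.
rewrite (msum_mon PhiB) /Phi; case: (eqVneq v w) => [->|vw].
  by case: ifP => // _; rewrite mcoeff0.
rewrite mcoeffZ mcoeffX (negbTE vw) mulr0 if_same.
by case: ifP => _; rewrite ?mcoeff0 // mcoeffZ mcoeffX (negbTE vw) mulr0.
Qed.

Lemma row_in_wpart t l : row_in (pred1 t) (wpart t l).
Proof.
move=> i w; rewrite mcoeff_msupp mcoeff_wpart /=.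
by case: ifP => // _; rewrite eqxx.
Qed.

Lemma row_in_sub_wpart t l : row_in (le^~ t) l ->
  row_in (lt^~ t) (fun i => l i - wpart t l i).
Proof.
move=> l_le i w; rewrite mcoeff_msupp mcoeffB mcoeff_wpart.
case: ifP => [_|wt]; rewrite ?subrr ?eqxx // subr0 -mcoeff_msupp => /l_le.
by rewrite /le wt.
Qed.

Lemma lead_wpart s t l : lead s (wpart t l) = if s == t then lead t l else 0.
Proof.
(* The sum may run over the larger support of [l i], the extra coefficients being zero. *)
transitivity (\sum_i \sum_(w <- msupp (l i))
    (if tmul w (head i) == s then
       (if tmul w (head i) == t then (l i)@_w else 0)
         * alphaT D w (vlc lt (g i)) else 0)).
  apply: eq_bigr => i _.
  pose Phi w a := if tmul w (head i) == s then a * alphaT D w (vlc lt (g i)) else 0.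
  have PhiB w : zmod_morphism (Phi w).
    by move=> a b; rewrite /Phi; case: ifP => _; rewrite ?mulrBl ?subr0.
  rewrite (msum_wide PhiB (msupp_uniq (l i))) => [|w].
    by apply: eq_bigr => w _; rewrite /Phi mcoeff_wpart.
  by rewrite !mcoeff_msupp mcoeff_wpart; case: ifP => // _; rewrite eqxx.
case: (eqVneq s t) => [->|/eqP st].
  by apply: eq_bigr => i _; apply: eq_bigr => w _; case: eqP => // ->; rewrite eqxx.
rewrite big1 // => i _; rewrite big1 // => w _.
by case: eqP => // ws; case: eqP => [wt|_]; rewrite ?mul0r //; congruence.
Qed.

Lemma homogeneous_weight (h : 'rV[gr_ore D]_u) :
  homogeneous lt g h -> exists t, row_in (pred1 t) (fun i => h 0 i).
Proof.
case=> a [lam [hE same]].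
have {hE}hi i : h 0 i = gr_mon D (a i) (lam i).
  rewrite hE summxE (bigD1 i) //= big1 ?addr0.
    by rewrite !mxE !eqxx mulr1.
  by move=> j ji; rewrite !mxE eq_sym (negbTE ji) andbF mulr0.
have supp i w : w \in msupp (h 0 i : P) -> a i != 0 /\ w = lam i.
  rewrite hi => wh; split; last exact: mem_msuppZX wh.
  by apply: contraTneq wh => ->; rewrite /gr_mon scale0r msupp0.
case: (pickP (fun i => a i != 0)) => [i0 ai0|a0].
  exists (tmul (lam i0) (head i0)) => i w /supp[ai ->] /=.
  exact/eqP/same.
(* Here the row is zero, and any weight fits. *)
by exists (0%MM, ord0) => i w /supp[]; rewrite a0.
Qed.

(** T(l_i) dominates every term of l_i, so bounding its weight bounds all weights of the row. *)
Lemma groebner_representationP f :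
  left_groebner_representation prec lt g f <->
  f = 0 \/ exists2 l, f = lincomb l & row_in (le^~ (vT lt f)) l.
Proof.
have [_ precM _] := hlt.
split=> -[->|[l fE l_le]]; try by left.
  right; exists l => // i w wl.
  have li0 : l i != 0 by apply: contraTneq wl => ->; rewrite msupp0.
  apply: term_le_trans (l_le i li0).
  have := seq_max_ge hprec.1 0%MM wl; rewrite -/(oT prec (l i)).
  by move=> /predU1P[<-|/precM ww]; rewrite /le ?eqxx // ww orbT.
right; exists l => // i li0; apply: l_le; apply: seq_max_mem.
by rewrite msupp_eq0.
Qed.

(** * Lowering the weights of a row *)

Definition reducible t l : Prop :=
  exists2 l', row_in (lt^~ t) l' & lincomb l = lincomb l'.

Lemma reducible_sum t (I : eqType) (r : seq I) (p : pred I) (F : I -> 'I_u -> P) :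
  (forall j, p j -> reducible t (F j)) ->
  reducible t (fun i => \sum_(j <- r | p j) F j i).
Proof.
move=> redF; elim: r => [|j r [l lt_l lE]].
  exists (fun=> 0); first exact: weights_in0.
  by apply: eq_lincomb => i; rewrite big_nil.
case pj: (p j); last first.
  by exists l => //; rewrite -lE; apply: eq_lincomb => i; rewrite big_cons pj.
have [l' lt_l' l'E] := redF _ pj.
exists (fun i => l' i + l i); first exact: weights_inD.
rewrite lincombD -lE -l'E -lincombD.
by apply: eq_lincomb => i; rewrite big_cons pj.
Qed.

(* The S-polynomial attached to a homogeneous syzygy has its leading term     *)
(* below the weight of the syzygy, hence so has its Groebner representation.  *)
Lemma reducible_gr_act t a w l : row_in (pred1 t) l -> lead t l = 0 ->
  left_groebner_representation prec lt g (lincomb l) ->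
  reducible (tmul w t) (fun i => a *: gr_act w (l i)).
Proof.
move=> l_t lead0 /groebner_representationP rep.
have l_le : row_in (le^~ t) l.
  by apply: weights_inW l_t => s /= /eqP->; rewrite /le eqxx.
have [l1 l1_lt l1E] : reducible t l.
  case: rep => [l0|[l1 l1E l1_le]].
    by exists (fun=> 0); [exact: weights_in0|rewrite l0 lincomb0].
  have [l0|l_neq0] := eqVneq (lincomb l) 0.
    by exists (fun=> 0); [exact: weights_in0|rewrite l0 lincomb0].
  exists l1 => //; apply: weights_inW l1_le => s /= /term_le_lt_trans; apply.
  by apply: vT_lt (vec_le_lincomb l_le) _; rewrite ?vcoef_lincomb.
have low := weights_in_ore_act_gr (w := w) (a := a) l_le.
(* The graded multiple is the Ore multiple minus a low error; [l1] may replace [l] only in the Ore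
   multiple, whose combination is a multiple of [lincomb l]. *)
exists (fun i => a *: ore_act D w (l1 i)
                 - (a *: ore_act D w (l i) - a *: gr_act w (l i))).
  by apply: weights_inD (weights_inN low); apply: weights_in_ore_act_lt.
rewrite lincombD lincombN lincombD lincombN !lincomb_monZ l1E.
by rewrite opprD opprK addrA subrr add0r.
Qed.

Section Reduction.

Variable G : 'rV[gr_ore D]_u -> Prop.
Hypothesis hG : gebauer_moeller_set lt g G.
Hypothesis repG : forall h, G h ->
  left_groebner_representation prec lt g (lincomb (fun i => h 0 i)).

(** Expanded in the homogeneous generators, h is a sum of their monomial multiples; only those of
    weight t matter, and each is reducible by [reducible_gr_act]. *)
Lemma reducible_syzygy t (h : 'rV[gr_ore D]_u) :
  row_in (pred1 t) (fun i => h 0 i) -> syz_map lt g h = 0 ->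
  reducible t (fun i => h 0 i).
Proof.
have [Ghom Ggen] := hG.
move=> h_t /Ggen[k [s [v [Gv hE]]]].
have /fin_all_exists[tv tvP] j : exists t', row_in (pred1 t') (fun i => v j 0 i).
  exact/homogeneous_weight/Ghom.
have lead_v j : lead (tv j) (fun i => v j 0 i) = 0.
  rewrite -syz_mapE (_ : syz_map lt g (v j) = 0) ?mxE ?mcoeff0 //.
  apply/Ggen; exists 1%N, (fun=> 1), (fun=> v j); split=> //.
  by rewrite big_ord1 scale1r.
pose T j w i : P := (s j : P)@_w *: gr_act w (v j 0 i).
have hiE i : h 0 i = \sum_j \sum_(w <- msupp (s j : P)) T j w i.
  rewrite hE summxE; apply: eq_bigr => j _; rewrite mxE.
  by rewrite [LHS]gr_mulE.
have T_weight j w : row_in (pred1 (tmul w (tv j))) (T j w).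
  exact: weights_in_gr_act (tvP j).
(* As h is homogeneous, the multiples of other weights cancel among themselves: compare
   coefficients, at monomials of weight t and at the others. *)
have {}hiE i : h 0 i =
    \sum_j \sum_(w <- msupp (s j : P) | tmul w (tv j) == t) T j w i.
  apply/(mpolyP (h 0 i : P)) => x; rewrite raddf_sum /=.
  under eq_bigr do rewrite raddf_sum big_mkcond /=.
  have [xt|xt] := eqVneq (tmul x (head i)) t.
    rewrite hiE raddf_sum; apply: eq_bigr => j _ /=.
    rewrite raddf_sum; apply: eq_bigr => w _ /=; case: eqP => // wt.
    apply/eqP/negPn/negP; rewrite -mcoeff_msupp => /(T_weight j w)/eqP.
    by rewrite xt => /esym.
  rewrite big1 => [|j _]; last first.
    rewrite big1 // => w _; case: eqP => // wt.
    apply/eqP/negPn/negP; rewrite -mcoeff_msupp => /(T_weight j w).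
    by rewrite /= wt (negbTE xt).
  apply/eqP/negPn/negP; rewrite -mcoeff_msupp => /h_t.
  by rewrite /= (negbTE xt).
have [l l_lt lE] : reducible t
    (fun i => \sum_j \sum_(w <- msupp (s j : P) | tmul w (tv j) == t) T j w i).
  apply: reducible_sum => j _; apply: reducible_sum => w /eqP <-.
  exact: reducible_gr_act (tvP j) (lead_v j) (repG (Gv j)).
by exists l => //; rewrite -lE; apply: eq_lincomb.
Qed.

(** The component of weight t is a syzygy: its [lead] vanishes at t by hypothesis and elsewhere by
    homogeneity. The rest of the row is already below t. *)
Lemma reducible_cancel t l :
  row_in (le^~ t) l -> vcoef t (lincomb l) = 0 -> reducible t l.
Proof.
move=> l_le; rewrite vcoef_lincomb // => lead0.
pose h : 'rV[gr_ore D]_u := \row_i (wpart t l i : gr_ore D).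
have hE i : h 0 i = wpart t l i by rewrite mxE.
have lead_h s : lead s (fun i => h 0 i) = 0.
  transitivity (lead s (wpart t l)).
    by apply: eq_bigr => i _; rewrite hE.
  by rewrite lead_wpart lead0 if_same.
have [||l' l'_lt l'E] := @reducible_syzygy t h.
- by move=> i w; rewrite hE => /row_in_wpart.
- apply/rowP => i; rewrite mxE.
  apply/(mpolyP (syz_map lt g h 0 i : P)) => w.
  by rewrite (syz_mapE h (w, i)) lead_h mcoeff0.
exists (fun i => l' i + (l i - wpart t l i)).
  by apply: weights_inD => //; apply: row_in_sub_wpart.
rewrite lincombD -l'E -lincombD; apply: eq_lincomb => i.
by rewrite hE addrC subrK.
Qed.

(** Descent on the bound t: if the coefficient at t is nonzero, then t is T(f); otherwise the row
    can be replaced by one with a smaller attained bound. *)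
Lemma groebner_row l : lincomb l != 0 ->
  exists2 l', lincomb l = lincomb l' & row_in (le^~ (vT lt (lincomb l))) l'.
Proof.
have [[_ _ _ wf] _ _] := hlt.
have bound l' : lincomb l' != 0 -> exists i w, w \in msupp (l' i) /\
    row_in (le^~ (tmul w (head i))) l'.
  move=> l'0; apply: weights_in_max.
  apply/existsP; apply: contra_neqT l'0 => /existsPn l'0.
  by rewrite -lincomb0; apply: eq_lincomb => i; apply/eqP/negPn/l'0.
move=> l0; have [i [w [_ ]]] := bound l l0.
move: (tmul w (head i)) l l0 => {i w}.
elim/(well_founded_ind wf) => t IH l l0 l_le.
have [lT|lT] := eqVneq (vcoef t (lincomb l)) 0; last first.
  exists l => //; have := vT_le l0 (vec_le_lincomb l_le).
  case/predU1P=> [->//|]; move: lT => /[swap] lt_t.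
  by rewrite (vcoef_eq0 (vec_le_vT (f := lincomb l)) lt_t) eqxx.
have [l' l'_lt l'E] := reducible_cancel l_le lT.
rewrite l'E in l0 *.
have [i [w [wl' l'_le]]] := bound l' l0.
exact: IH (l'_lt _ _ wl') l' l0 l'_le.
Qed.

Lemma groebner_basis_of_representations : left_groebner_basis lt g.
Proof.
move=> f [l0 f_span] f0.
have [l] : exists2 l, f = lincomb l & row_in (le^~ (vT lt f)) l.
  by rewrite f_span in f0 *; apply: groebner_row.
set t := vT lt f => fE l_le.
have lcE : vlc lt f = lead t l by rewrite -vcoef_lincomb // -fE.
(* The monomials of the row of weight exactly T(f) are those that build M(f). *)
pose r := [seq (i, w) | i <- index_enum 'I_u,
             w <- [seq w <- msupp (l i) | tmul w (head i) == t]].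
have rP p : p \in r -> (l p.1)@_p.2 != 0 /\ tmul p.2 (head p.1) = t.
  case/allpairsPdep=> [i [w [_ + ->]]]; rewrite mem_filter mcoeff_msupp /=.
  by case/andP=> /eqP.
pose p (q : 'I_(size r)) := tnth (in_tuple r) q.
have pr q : p q \in r by apply: mem_tnth.
exists (size r), (fun q => (l (p q).1)@_(p q).2), (fun q => (p q).2),
  (fun q => (p q).1); split=> [q|q|]; try by case: (rP _ (pr q)).
rewrite -(big_tnth _ _ r xpredT (fun p : 'I_u * 'X_{1..n} =>
  gr_mon D (l p.1)@_p.2 p.2 *: vM lt (g p.1))) big_seq.
rewrite (sum_head_monomials (t := t) r) => [|q /rP[]//]; rewrite -big_seq.
rewrite /vM -/t lcE /lead big_allpairs_dep; congr (gr_mon D _ _ *: _).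
apply: eq_bigr => i _; rewrite big_filter.
by rewrite [RHS]big_mkcond.
Qed.

End Reduction.

(** Division: subtracting the combination that matches M(f) cancels the term T(f), and well-founded
    induction on T(f) represents the remainder. *)
Lemma representation_of_groebner_basis l : left_groebner_basis lt g ->
  left_groebner_representation prec lt g (lincomb l).
Proof.
have [[_ _ _ wf] _ _] := hlt.
move=> GB; apply/groebner_representationP.
have [l0|l0] := eqVneq (lincomb l) 0; [by left|right].
move: {-2}(vT lt (lincomb l)) (erefl (vT lt (lincomb l))) => t.
elim/(well_founded_ind wf): t l l0 => t IH l l0 /esym tE.
have [k [a [lam [j [_ lamE lcE]]]]] := GB (lincomb l) (ex_intro _ l erefl) l0.
rewrite tE in lamE lcE *.
(* Several q may use the same generator, so their monomials are collected by [j q]. *)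
pose l1 i : P := \sum_(q | j q == i) a q *: 'X_[lam q].
have l1_le : row_in (le^~ t) l1.
  move=> i w; rewrite /l1 -big_filter => /mem_msupp_sum[q].
  by rewrite mem_filter => /andP[/eqP<- _] /mem_msuppZX ->; rewrite lamE /le eqxx.
have l1E : lincomb l1 = \sum_q ore_mon D (a q) (lam q) *: g (j q).
  rewrite (partition_big j xpredT) //=; apply: eq_bigr => i _.
  rewrite scaler_suml; apply: eq_bigr => q /eqP->; by [].
pose f := lincomb l - lincomb l1.
have fE : f = lincomb (fun i => l i - l1 i) by rewrite lincombD lincombN.
have f_le : vec_le t f.
  apply/vec_leD/vec_leN/vec_le_lincomb => //.
  by rewrite -tE; apply: vec_le_vT.
have ft : vcoef t f = 0.
  move: lcE; rewrite (sum_head_monomials (t := t)) // /vM tE.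
  move=> /(@gr_mon_delta_inj t) lcE.
  have lE : vcoef t (lincomb l) = vlc lt (lincomb l) by rewrite -tE.
  rewrite raddfB /= lE lcE l1E raddf_sum /=.
  apply/eqP; rewrite subr_eq0; apply/eqP/eq_bigr => q _.
  by rewrite -(lamE q) vcoef_monZ //; apply: vec_le_vT.
have [f0|f0] := eqVneq f 0.
  by exists l1 => //; apply/eqP; rewrite -subr_eq0; apply/eqP.
have f_lt := vT_lt f0 f_le ft.
rewrite fE in f0 f_lt.
have [l2 l2E l2_le] := IH _ f_lt _ f0 erefl.
exists (fun i => l1 i + l2 i); first by rewrite lincombD -l2E -fE addrC subrK.
apply: weights_inD => //; apply: weights_inW l2_le => s /= s_le.
by rewrite /le (term_le_lt_trans s_le f_lt) orbT.
Qed.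

End Rows.
End Weights.

(** B(i,j) is the lift of the syzygy b(i,j); this makes the hypothesis on S-polynomials the
    condition [repG] on the generators. *)
Lemma spoly_lincomb (R : idomainType) (n m u : nat) (D : ore_data R n)
    (lt : rel (vterm n m.+1)) (g : 'I_u -> 'rV[ore D]_m.+1)
    (c : 'I_u -> 'I_u -> R) i j :
  spoly lt g c i j = lincomb g (fun k => spair_syz lt g c i j 0 k).
Proof.
have delta_sum (q : 'I_u) (x : ore D) :
    \sum_k (x * (k == q)%:R) *: g k = x *: g q.
  rewrite (bigD1 q) //= eqxx mulr1 big1 ?addr0 // => k /negbTE->.
  by rewrite mulr0 scale0r.
rewrite /spoly -!delta_sum -sumrB; apply: eq_bigr => k _; rewrite -scalerBl.
congr (_ *: _); rewrite !mxE /=.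
by do 2!case: eqP => _; rewrite ?mulr1 ?mulr0.
Qed.

Theorem corollary61 (R : idomainType) (zR : left_zacharias R)
    (pidR : principal_ideal_domain R)
    (n m u : nat) (D : ore_data R n)
    (autD : forall i : 'I_n, bijective (oalpha D i))
    (prec : rel 'X_{1..n}) (lt : rel (vterm n m.+1))
    (hprec : term_ordering prec) (hlt : compatible_term_ordering prec lt)
    (g : 'I_u -> 'rV[ore D]_m.+1) (g_neq0 : forall i, g i != 0)
    (c : 'I_u -> 'I_u -> R) (hc : lcm_choice lt g c)
    (GM : {set 'I_u * 'I_u}) (hGM : useful_spair_set lt g c GM) :
  left_groebner_basis lt g <->
  (forall i j : 'I_u, (i, j) \in GM ->
     left_groebner_representation prec lt g (spoly lt g c i j)).
Proof.
split=> [GB i j _|rep].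
  rewrite spoly_lincomb; exact: representation_of_groebner_basis GB.
apply: (groebner_basis_of_representations hprec hlt hGM.2) => _ [i [j [ij ->]]].
by rewrite -spoly_lincomb; apply: rep.
Qed.
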